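(* Every lattice $L$ with more than one element has a proper congruence-preserving extension $K$. That is, for every lattice $L$ with more than one element there exists a lattice $K$ that contains $L$ as a sublattice, with $K - L \neq \varnothing$, such that the map $\Theta \mapsto \Theta_L$ sending a congruence $\Theta$ of $K$ to its restriction to $L$ is a bijection from the set of congruences of $K$ onto the set of congruences of $L$.
   Context: A lattice $K$ is an extension of a lattice $L$ if $L$ is a sublattice of $K$ (as usual, $L$ may be identified with its image under a lattice embedding into $K$). For a congruence $\Theta$ of $K$, $\Theta_L$ denotes the restriction of $\Theta$ to $L$, which is a congruence of $L$. An extension $K$ of $L$ is congruence-preserving if every congruence of $L$ has exactly one extension to a congruence of $K$, i.e., the map $\Theta \mapsto \Theta_L$ is a bijection between the congruences of $K$ and the congruences of $L$. The extension is proper if $K - L \neq \varnothing$. Lattices are not assumed to be bounded. *)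

(* Defs.v *)
From HB Require Import structures.
From Corelib Require Import RelationClasses.
From mathcomp Require Import all_boot all_order.
From mathcomp Require Import boolp classical_sets functions.

Set Implicit Arguments.
Unset Strict Implicit.
Unset Printing Implicit Defensive.

Local Open Scope classical_set_scope.

(* Congruences are [Prop]-valued relations, so that under propositional and
   functional extensionality (boolp) Leibniz equality of congruences is
   equality of their graphs. *)
Record congruence (d : Order.disp_t) (L : latticeType d)
    (Theta : L -> L -> Prop) : Prop := Congruence {
  congruence_equiv : Equivalence Theta;
  congruence_meet : forall x1 y1 x2 y2 : L, Theta x1 y1 -> Theta x2 y2 ->
    Theta (x1 `&` x2)%O (y1 `&` y2)%O;
  congruence_join : forall x1 y1 x2 y2 : L, Theta x1 y1 -> Theta x2 y2 ->
    Theta (x1 `|` x2)%O (y1 `|` y2)%O }.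

Definition Con (d : Order.disp_t) (L : latticeType d) : set (L -> L -> Prop) :=
  [set Theta | congruence Theta].
Arguments Con {d} L _.

(* In the definitions below L is identified with its image under f. *)
Definition restriction (L K : Type) (f : L -> K) (Theta : K -> K -> Prop) :
  L -> L -> Prop := fun x y => Theta (f x) (f y).

Definition lattice_extension (d d' : Order.disp_t)
    (L : latticeType d) (K : latticeType d') (f : {lmorphism L -> K}) : Prop :=
  injective f.

Definition proper_extension (d d' : Order.disp_t)
    (L : latticeType d) (K : latticeType d') (f : {lmorphism L -> K}) : Prop :=
  lattice_extension f /\ [set: K] `\` range f !=set0.

Definition congruence_preserving_extension (d d' : Order.disp_t)
    (L : latticeType d) (K : latticeType d') (f : {lmorphism L -> K}) : Prop :=
  lattice_extension f /\ set_bij (Con K) (Con L) (restriction f).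

(* Main.v *)
(** The extension is the lattice of Boolean triples of [L]: the triples
    [(x, y, z)] such that [x = (x \/ y) /\ (x \/ z)], and symmetrically for [y]
    and [z]. They are the closed elements of a closure operator on [L^3], so they
    form a lattice with componentwise meets, into which [L] embeds diagonally.
    On an interval [[u, v]], the triples [(v, u, u)], [(u, v, u)], [(u, u, v)]
    generate an M_3 with bounds [(u, u, u)] and [(v, v, v)]. Perspectivities in
    this M_3 express the diagonal triples of the components of [p] as lattice
    polynomials in [p], and conversely [p] as a lattice polynomial in these
    diagonal triples. Hence a congruence of the Boolean triples is the
    componentwise extension of its restriction to the diagonal. *)

Require Import Defs.
From HB Require Import structures.
From mathcomp Require Import all_boot all_order.
From mathcomp Require Import boolp classical_sets functions.

Set Implicit Arguments.
Unset Strict Implicit.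
Unset Printing Implicit Defensive.

Import Order.LTheory.

Local Open Scope order_scope.

Section BooleanTriples.
Context (d : Order.disp_t) (L : latticeType d).

(** * The closure operator on [L * L * L] *)

Definition triple_le (p q : L * L * L) : bool :=
  [&& p.1.1 <= q.1.1, p.1.2 <= q.1.2 & p.2 <= q.2].

Definition triple_meet (p q : L * L * L) : L * L * L :=
  (p.1.1 `&` q.1.1, p.1.2 `&` q.1.2, p.2 `&` q.2).

Definition triple_join (p q : L * L * L) : L * L * L :=
  (p.1.1 `|` q.1.1, p.1.2 `|` q.1.2, p.2 `|` q.2).

Definition boolean_closure (p : L * L * L) : L * L * L :=
  ((p.1.1 `|` p.1.2) `&` (p.1.1 `|` p.2),
   (p.1.2 `|` p.1.1) `&` (p.1.2 `|` p.2),
   (p.2 `|` p.1.1) `&` (p.2 `|` p.1.2)).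

Definition is_boolean (p : L * L * L) : bool := boolean_closure p == p.

Lemma triple_le_refl : reflexive triple_le.
Proof. by move=> p; rewrite /triple_le !lexx. Qed.

Lemma triple_le_anti : antisymmetric triple_le.
Proof.
move=> [[x y] z] [[x' y'] z'] /andP[/and3P[/= ? ? ?] /and3P[/= ? ? ?]].
by congr (_, _, _); apply: le_anti; apply/andP.
Qed.

Lemma triple_le_trans : transitive triple_le.
Proof.
move=> q p r /and3P[pq1 pq2 pq3] /and3P[qr1 qr2 qr3]; apply/and3P.
by split; [exact: le_trans pq1 qr1|exact: le_trans pq2 qr2
          |exact: le_trans pq3 qr3].
Qed.

Lemma triple_meetP p q r :
  triple_le p (triple_meet q r) = triple_le p q && triple_le p r.
Proof. by rewrite /triple_le !lexI; do !case: (_ <= _). Qed.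

Lemma triple_joinP p q r :
  triple_le (triple_join p q) r = triple_le p r && triple_le q r.
Proof. by rewrite /triple_le !leUx; do !case: (_ <= _). Qed.

Lemma le_boolean_closure p : triple_le p (boolean_closure p).
Proof. by rewrite /triple_le !lexI !leUl. Qed.

Lemma boolean_closureS p q :
  triple_le p q -> triple_le (boolean_closure p) (boolean_closure q).
Proof. by case/and3P=> ? ? ?; apply/and3P; split; rewrite leI2 ?leU2. Qed.

(** Closing leaves pairwise joins unchanged: the new components grow, yet any two of them stay below
    the join of the two old ones. The closure depends only on these joins. *)
Lemma boolean_closureK p : is_boolean (boolean_closure p).
Proof.
have closed (a b a' b' : L) : a <= a' -> b <= b' -> a' <= a `|` b ->
    b' <= a `|` b -> a' `|` b' = a `|` b.
  by move=> aa bb ? ?; apply: le_anti; rewrite leUx leU2 // andbT; apply/andP.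
have /and3P[] := le_boolean_closure p; case: p => [[x y] z] /= le1 le2 le3.
rewrite /is_boolean {1}/boolean_closure /=.
by apply/eqP; congr (_ `&` _, _ `&` _, _ `&` _); apply: closed => //;
  rewrite ?leIl ?leIr // 1?[X in _ <= X]joinC ?leIl ?leIr.
Qed.

Lemma is_boolean_meet p q :
  is_boolean p -> is_boolean q -> is_boolean (triple_meet p q).
Proof.
move=> /eqP bp /eqP bq; apply/eqP/triple_le_anti.
rewrite le_boolean_closure andbT triple_meetP -{2}bp -{3}bq.
have := triple_le_refl (triple_meet p q).
by rewrite triple_meetP => /andP[? ?]; rewrite !boolean_closureS.
Qed.

(** * The lattice of Boolean triples and its diagonal *)

Record boolean_triple := BooleanTriple {
  btval :> L * L * L;
  btvalP : is_boolean btval }.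

HB.instance Definition _ := [isSub for btval].
HB.instance Definition _ := [Choice of boolean_triple by <:].

Definition bt_le (p q : boolean_triple) := triple_le p q.
Definition bt_meet (p q : boolean_triple) : boolean_triple :=
  BooleanTriple (is_boolean_meet (btvalP p) (btvalP q)).
Definition bt_join (p q : boolean_triple) : boolean_triple :=
  BooleanTriple (boolean_closureK (triple_join p q)).

Lemma bt_le_refl : reflexive bt_le.
Proof. by move=> p; apply: triple_le_refl. Qed.

Lemma bt_le_anti : antisymmetric bt_le.
Proof. by move=> p q /triple_le_anti /val_inj. Qed.

Lemma bt_le_trans : transitive bt_le.
Proof. by move=> q p r; apply: triple_le_trans. Qed.

HB.instance Definition _ := Order.Le_isPOrder.Build d boolean_triple
  bt_le_refl bt_le_anti bt_le_trans.

Lemma bt_meetP (p q r : boolean_triple) :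
  (p <= bt_meet q r) = (p <= q) && (p <= r).
Proof. exact: triple_meetP. Qed.

(** As [r] is closed, it lies above a closure as soon as it lies above the triple being closed. *)
Lemma bt_joinP (p q r : boolean_triple) :
  (bt_join p q <= r) = (p <= r) && (q <= r).
Proof.
rewrite -[(p <= r) && (q <= r)]triple_joinP; apply/idP/idP.
  by apply: triple_le_trans; apply: le_boolean_closure.
move/boolean_closureS; have /eqP-> // := btvalP r.
Qed.

HB.instance Definition _ := Order.POrder_MeetJoin_isLattice.Build d
  boolean_triple bt_meetP bt_joinP.

Lemma btval_inj : injective btval.
Proof. exact: val_inj. Qed.

Lemma btval_meet (p q : boolean_triple) :
  btval (p `&` q) = triple_meet p q.
Proof. by []. Qed.

Lemma btval_join (p q : boolean_triple) :
  btval (p `|` q) = boolean_closure (triple_join p q).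
Proof. by []. Qed.

Lemma is_boolean_diag (x : L) : is_boolean (x, x, x).
Proof. by rewrite /is_boolean /boolean_closure /= !joinxx meetxx. Qed.

Definition diag (x : L) : boolean_triple := BooleanTriple (is_boolean_diag x).

Lemma diag_meet : {morph diag : x y / x `&` y}.
Proof. by move=> x y; apply: btval_inj. Qed.

Lemma diag_join : {morph diag : x y / x `|` y}.
Proof.
move=> x y; apply: btval_inj; rewrite btval_join.
by rewrite (eqP (is_boolean_diag _)).
Qed.

Lemma diag_homo : {homo diag : x y / x <= y}.
Proof. by move=> x y xy; apply/and3P. Qed.

HB.instance Definition _ := Order.isOrderMorphism.Build d L d boolean_triple
  diag diag_homo.
HB.instance Definition _ := Order.isLatticeMorphism.Build d L d boolean_triple
  diag diag_meet diag_join.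

Lemma diag_inj : injective diag.
Proof. by move=> x y []. Qed.

(* For [u <= v] these are the triples [(v, u, u)], [(u, v, u)], [(u, u, v)]. *)
Definition atom1 u v := BooleanTriple (boolean_closureK (v, u, u)).
Definition atom2 u v := BooleanTriple (boolean_closureK (u, v, u)).
Definition atom3 u v := BooleanTriple (boolean_closureK (u, u, v)).

(** * Lattice polynomials over an interval *)

Section Interval.
Variables (u v : L).

Definition bounded (x : L) := (u <= x) && (x <= v).

(** A rewriting system for [u <= x <= v], which evaluates the polynomials below. *)
Lemma boundedE x : bounded x ->
  ((u `|` x = x) * (x `|` u = x) * (u `&` x = u) * (x `&` u = u)) *
  ((x `|` v = v) * (v `|` x = v) * (x `&` v = x) * (v `&` x = x)) *
  ((u `|` v = v) * (v `|` u = v) * (u `&` v = u) * (v `&` u = u)).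
Proof.
case/andP=> ux xv; have uv := le_trans ux xv.
by do !split; (apply: join_l || apply: join_r || apply: meet_l || apply: meet_r).
Qed.

Variable p : boolean_triple.
Hypotheses (up : diag u <= p) (pv : p <= diag v).

Lemma bounded_components : [/\ bounded p.1.1, bounded p.1.2 & bounded p.2].
Proof.
by case/and3P: up pv => /= ? ? ? /and3P[/= ? ? ?]; split; apply/andP.
Qed.

(** Write [x] for [p.1.1]. Then [q] is [(x, u, u)], its join with [atom2] is [(x, v, x)], and the
    meet with [atom3] is [(u, u, x)]. Finally [(x, u, x)] closes to [(x, x, x)]. *)
Lemma diag_component1 :
  let q := p `&` atom1 u v in
  diag p.1.1 = q `|` ((q `|` atom2 u v) `&` atom3 u v).
Proof.
have [/boundedE Ex /boundedE Ey /boundedE Ez] := bounded_components.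
apply: btval_inj; rewrite !(btval_join, btval_meet) /triple_join.
rewrite /triple_meet /boolean_closure /=.
by rewrite !(Ex, Ey, Ez, joinxx, meetxx).
Qed.

Lemma diag_component2 :
  let q := p `&` atom2 u v in
  diag p.1.2 = q `|` ((q `|` atom1 u v) `&` atom3 u v).
Proof.
have [/boundedE Ex /boundedE Ey /boundedE Ez] := bounded_components.
apply: btval_inj; rewrite !(btval_join, btval_meet) /triple_join.
rewrite /triple_meet /boolean_closure /=.
by rewrite !(Ex, Ey, Ez, joinxx, meetxx).
Qed.

Lemma diag_component3 :
  let q := p `&` atom3 u v in
  diag p.2 = q `|` ((q `|` atom1 u v) `&` atom2 u v).
Proof.
have [/boundedE Ex /boundedE Ey /boundedE Ez] := bounded_components.
apply: btval_inj; rewrite !(btval_join, btval_meet) /triple_join.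
rewrite /triple_meet /boolean_closure /=.
by rewrite !(Ex, Ey, Ez, joinxx, meetxx).
Qed.

Lemma join_diag_components :
  p = diag p.1.1 `&` atom1 u v `|`
      (diag p.1.2 `&` atom2 u v `|` diag p.2 `&` atom3 u v).
Proof.
have [/boundedE Ex /boundedE Ey /boundedE Ez] := bounded_components.
set q1 := _ `&` atom1 u v; set q2 := _ `&` atom2 u v; set q3 := _ `&` atom3 u v.
have q1E : btval q1 = (p.1.1, u, u).
  by rewrite btval_meet /triple_meet /= !(Ex, joinxx, meetxx).
have q2E : btval q2 = (u, p.1.2, u).
  by rewrite btval_meet /triple_meet /= !(Ey, joinxx, meetxx).
have q3E : btval q3 = (u, u, p.2).
  by rewrite btval_meet /triple_meet /= !(Ez, joinxx, meetxx).
have /and3P[/= up1 up2 up3] := up.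
apply: le_anti; apply/andP; split; last first.
  rewrite !leUx; apply/and3P; split; apply/and3P; rewrite ?(q1E, q2E, q3E);
    by split=> //=.
(* No closure has to be computed: the join is above each [qi], and each component of [p] occurs in
   one of them. *)
have := lexx (q1 `|` (q2 `|` q3)); rewrite {1}leUx leUx.
case/and3P=> /and3P[le1 _ _] /and3P[_ le2 _] /and3P[_ _ le3].
by apply/and3P; split; move: le1 le2 le3; rewrite q1E q2E q3E.
Qed.

End Interval.

(** * Congruences of the Boolean triples *)

Definition componentwise (theta : L -> L -> Prop) (p q : boolean_triple) : Prop :=
  [/\ theta p.1.1 q.1.1, theta p.1.2 q.1.2 & theta p.2 q.2].

(** Joins are preserved because the closure is itself given by lattice polynomials in the
    components. *)
Lemma congruence_componentwise theta :
  congruence theta -> congruence (componentwise theta).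
Proof.
case=> -[refl sym trans] cmeet cjoin; split; first split.
- by move=> p; split; apply: refl.
- by move=> p q [? ? ?]; split; apply: sym.
- by move=> p q r [? ? ?] [? ? ?]; split; apply: trans; eassumption.
- by move=> p q p' q' [? ? ?] [? ? ?]; split; apply: cmeet.
- move=> p q p' q' [? ? ?] [? ? ?]; rewrite /componentwise !btval_join /=.
  by split; apply: (cmeet); apply: (cjoin); apply: (cjoin).
Qed.

Lemma restriction_componentwise theta :
  restriction diag (componentwise theta) = theta.
Proof. by apply/funext => x; apply/funext => y; apply/propext; split=> [[]|]. Qed.

Lemma congruence_restriction Theta :
  congruence Theta -> congruence (restriction diag Theta).
Proof.
case=> -[refl sym trans] cmeet cjoin; split; first split.
- by move=> x; apply: refl.
- by move=> x y; apply: sym.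
- by move=> x y z; apply: trans.
- by move=> *; rewrite /restriction !diag_meet; apply: cmeet.
- by move=> *; rewrite /restriction !diag_join; apply: cjoin.
Qed.

(** [L] may lack a least or greatest element, so the bounds are built from [p]. *)
Lemma diag_interval (p : boolean_triple) :
  diag (p.1.1 `&` p.1.2 `&` p.2) <= p /\ p <= diag (p.1.1 `|` p.1.2 `|` p.2).
Proof.
split.
  by have := lexx (p.1.1 `&` p.1.2 `&` p.2); rewrite !lexI -andbA.
by have := lexx (p.1.1 `|` p.1.2 `|` p.2); rewrite !leUx -andbA.
Qed.

Lemma componentwise_restriction Theta : congruence Theta ->
  componentwise (restriction diag Theta) = Theta.
Proof.
case=> -[refl _ _] cmeet cjoin.
apply/funext => p; apply/funext => q; apply/propext.
(* One interval has to hold both [p] and [q], so that the same polynomials, with the same atoms as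
   constants, apply to both and [Theta] passes through them. *)
have [ul _] := diag_interval (p `&` q); have [_ lv] := diag_interval (p `|` q).
move: (X in diag X <= _) ul (X in _ <= diag X) lv => u.
rewrite lexI => /andP[up uq] v; rewrite leUx => /andP[pv qv].
split=> [[c1 c2 c3]|pq].
  rewrite (join_diag_components up pv) (join_diag_components uq qv).
  by do 2?[apply: (cjoin)]; apply: (cmeet).
rewrite /componentwise /restriction; split.
- rewrite (diag_component1 up pv) (diag_component1 uq qv).
  by apply: (cjoin); [|apply: (cmeet) => //; apply: (cjoin) => //]; apply: (cmeet).
- rewrite (diag_component2 up pv) (diag_component2 uq qv).
  by apply: (cjoin); [|apply: (cmeet) => //; apply: (cjoin) => //]; apply: (cmeet).
- rewrite (diag_component3 up pv) (diag_component3 uq qv).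
  by apply: (cjoin); [|apply: (cmeet) => //; apply: (cjoin) => //]; apply: (cmeet).
Qed.

End BooleanTriples.

Theorem theorem2 (d : Order.disp_t) (L : latticeType d)
    (L_gt1 : exists x y : L, x <> y) :
  exists (d' : Order.disp_t) (K : latticeType d') (f : {lmorphism L -> K}),
    proper_extension f /\ congruence_preserving_extension f.
Proof.
exists d, (boolean_triple L), (@diag d L).
split; split; try exact: diag_inj.
  have [x [y xy]] := L_gt1.
  have uv : bounded (x `&` y) (x `|` y) (x `|` y).
    by rewrite /bounded lexx leIxl ?leUl.
  (* With [u] the meet and [v] the join of [x] and [y], this atom is [(v, u, u)]. On the diagonal it
     would force [v = u], hence [x = y]. *)
  exists (atom1 (x `&` y) (x `|` y)); split=> // -[z _] /(congr1 val).
  rewrite /= /boolean_closure /= !(boundedE uv, joinxx, meetxx) => -[-> _ eq_uv].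
  apply: xy; apply: le_anti; apply/andP; split.
    by apply: le_trans (leUl x y) _; rewrite eq_uv leIr.
  by apply: le_trans (leUr y x) _; rewrite eq_uv leIl.
split.
- by move=> Theta; apply: congruence_restriction.
(* Each congruence is recovered from its restriction, which gives injectivity. *)
- move=> Theta Psi; rewrite !inE => cTheta cPsi eq_res.
  by rewrite -(componentwise_restriction cTheta) eq_res componentwise_restriction.
- move=> theta ctheta; exists (componentwise theta).
    exact: congruence_componentwise.
  exact: restriction_componentwise.
Qed.
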